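(* Let $(F,G)=\{f_j,g_j\}_{j\in\mathbb{J}}$ be a dual frame pair for a Hilbert space $\mathcal{H}$, and let $\Lambda\subset\mathbb{J}$ be an erasure set. Then there is a robust bridge set $\Omega\subset\mathbb{J}\setminus\Lambda$ for $\Lambda$ if and only if $\Lambda$ satisfies the minimal redundancy condition for $G$, i.e. $\overline{\mathrm{span}}\{g_j:j\notin\Lambda\}=\mathcal{H}$. In this case the robust bridge set $\Omega$ can be taken with $|\Omega|=\dim(\mathcal{F})$, where $\mathcal{F}=\mathrm{span}\{f_j:j\in\Lambda\}$.
   Context: Inner products are linear in the first variable. $\mathbb{J}$ is a finite or countable index set. A frame for a Hilbert space $\mathcal{H}$ is a sequence $\{f_j\}_{j\in\mathbb{J}}$ in $\mathcal{H}$ for which there are constants $0<A\le B<\infty$ with $A\|f\|^2\le\sum_{j}|\langle f,f_j\rangle|^2\le B\|f\|^2$ for all $f\in\mathcal{H}$. A dual frame pair $(F,G)=\{f_j,g_j\}_{j\in\mathbb{J}}$ consists of frames $F=\{f_j\}$ and $G=\{g_j\}$ for $\mathcal{H}$ with $f=\sum_{j\in\mathbb{J}}\langle f,g_j\rangle f_j$ (norm convergence) for all $f\in\mathcal{H}$. An erasure set is a finite subset $\Lambda\subset\mathbb{J}$. A bridge set for $\Lambda$ is a finite set $\Omega\subset\mathbb{J}\setminus\Lambda$. For finite $\Lambda,\Omega\subset\mathbb{J}$ (with fixed enumerations), $B(F,G,\Lambda,\Omega)=(\langle f_j,g_k\rangle)_{j\in\Lambda,\,k\in\Omega}$ (rows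 indexed by $\Lambda$, columns by $\Omega$), and $B(F,G,\Lambda,\Lambda)=(\langle f_j,g_k\rangle)_{j,k\in\Lambda}$. A bridge set $\Omega$ is robust if the matrix equation $B(F,G,\Lambda,\Omega)C=B(F,G,\Lambda,\Lambda)$ has a solution $C$ (a complex matrix with rows indexed by $\Omega$ and columns by $\Lambda$); equivalently, for each $k\in\Lambda$ there is $g_k'\in\mathrm{span}\{g_\ell:\ell\in\Omega\}$ with $f_j\perp(g_k-g_k')$ for all $j,k\in\Lambda$. *)

(* Defs.v *)
From HB Require Import structures.
From mathcomp Require Import all_boot all_order all_algebra finmap complex.
From mathcomp Require Import all_classical all_reals all_analysis.
From mathcomp Require summability.

Set Implicit Arguments.
Unset Strict Implicit.
Unset Printing Implicit Defensive.

Import Order.TTheory GRing.Theory Num.Theory.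
Import numFieldNormedType.Exports.

Local Open Scope classical_set_scope.
Local Open Scope complex_scope.
Local Open Scope ring_scope.

(* Together with the completeness of [H], this makes [(H, dot)] a complex
   Hilbert space.  [{dot H for Num.conj}] is the library's type of positive
   definite Hermitian forms, linear in the first variable. *)
Definition induces_norm (R : realType) (H : normedModType R[i])
    (dot : {dot H for Num.conj}) : Prop :=
  forall x : H, `|x| ^+ 2 = dot x x.

(* In a normed module over [R[i]] the norm is [R[i]]-valued (it is a
   nonnegative real); this is its value in [R]. *)
Definition rnorm (R : realType) (V : normedZmodType R[i]) (x : V) : R :=
  complex.Re `|x|.

Section Span.
Context {R : realType} {H : normedModType R[i]}.

Definition lspan (S : set H) : set H :=
  [set x | exists n (c : 'I_n -> R[i]) (v : 'I_n -> H),
     (forall i, S (v i)) /\ x = \sum_(i < n) c i *: v i].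

Definition lin_indep (n : nat) (b : 'I_n -> H) : Prop :=
  forall c : 'I_n -> R[i], \sum_(i < n) c i *: b i = 0 -> forall i, c i = 0.

Definition has_dim (V : set H) (n : nat) : Prop :=
  exists b : 'I_n -> H, lin_indep b /\ lspan (range b) = V.

End Span.

Section Frames.
Context {R : realType} {H : normedModType R[i]} (dot : {dot H for Num.conj}).
Context {J : countType}.
Implicit Types (f g : J -> H) (L O : {fset J}).

Definition is_frame f : Prop :=
  exists A B : R, [/\ 0 < A, A <= B &
    forall x : H,
      ((A * rnorm x ^+ 2)%:E <=
         \esum_(j in [set: J]) (rnorm (dot x (f j)) ^+ 2)%:E)%E /\
      (\esum_(j in [set: J]) (rnorm (dot x (f j)) ^+ 2)%:E <=
         (B * rnorm x ^+ 2)%:E)%E].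

(* [summability.totally] is the filter of the finite subsets of [J] directed
   by inclusion.  Both families being frames, the series converges
   unconditionally, so this agrees with convergence along any enumeration
   of [J]. *)
Definition dual_frame_pair f g : Prop :=
  [/\ is_frame f, is_frame g &
    forall x : H,
      summability.partial_sum (fun j => dot x (g j) *: f j)
        @ summability.totally --> x].

(* Rows and columns are enumerated by the lists underlying [L] and [O];
   the fset cardinal [#|` L|] is by definition the length of that list. *)
Definition bridge_mx f g L O : 'M[R[i]]_(#|` L|, #|` O|) :=
  \matrix_(i, k) dot (f (tnth (in_tuple L) i)) (g (tnth (in_tuple O) k)).

Definition bridge_set L O : Prop := [disjoint O & L]%fset.

Definition robust f g L O : Prop :=
  exists C : 'M[R[i]]_(#|` O|, #|` L|),
    bridge_mx f g L O *m C = bridge_mx f g L L.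

Definition minimal_redundancy g L : Prop :=
  closure (lspan [set g j | j in [set j | j \notin L]]) = [set: H].

End Frames.

(* Main.v *)
Require Import Defs.
From mathcomp Require Import all_boot all_order all_algebra finmap complex.
From mathcomp Require Import all_classical all_reals all_analysis.
From mathcomp Require Import ring lra.
From mathcomp Require summability.
Import Order.TTheory GRing.Theory Num.Theory.
Import numFieldNormedType.Exports.
Local Open Scope classical_set_scope.
Local Open Scope complex_scope.
Local Open Scope ring_scope.

(** Write [v_k] for the vector of the inner products [<f_j, g_k>], [j] in
    [Lambda]; the [v_k] with [k] in [Omega] are the columns of the bridge matrix.

    A robust bridge set gives minimal redundancy.  Robustness says that each
    erased [g_k] is a combination of the [g_l], [l] in [Omega], plus a vector
    [h_k] orthogonal to every [f_j] with [j] in [Lambda].  In the expansion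
    [h_k = \sum_j <h_k, f_j> g_j] the terms over [Lambda] vanish, so [h_k], and
    then [g_k], lies in the closed span of the [g_j], [j] not in [Lambda].  All
    the [g_j] lie there, hence so does every [x = \sum_j <x, f_j> g_j]
    ([robust_redundancy]).  The frame pair provides the expansion with [f] and
    [g] in the other roles; this one follows by duality, from the pairing of
    both sides with vectors and from the Bessel bounds ([dual_expansion]).

    Minimal redundancy gives a robust bridge set.  Choose [Omega] outside
    [Lambda] with the [v_k], [k] in [Omega], forming a maximal linearly
    independent family.  A row [a] that annihilates the bridge matrix [B]
    annihilates every [v_k] with [k] not in [Lambda]; thus [\sum_j a_j f_j] is
    orthogonal to a set with dense span and is zero.  The columns of [B] being
    independent, [B] has a left inverse [P], and the rows of [1 - B P]
    annihilate [B].  Therefore [f_i = \sum_j (B P)_ij f_j] for every [i] in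
    [Lambda].  Pairing with [g_k], [k] in [Lambda], gives the solution
    [C = P B(Lambda, Lambda)]; and the vectors [b_k = \sum_j P_kj f_j], which
    span the [f_j] and are biorthogonal to the [g_k], [k] in [Omega], form a
    basis of size [|Omega|] of the span of the [f_j] ([redundancy_robust]). *)

(** * Linear spans and their closures *)

Section LinearSpan.
Context {R : realType} {H : normedModType R[i]}.
Implicit Types (S W : set H) (x y z : H).

Definition is_subspace W : Prop :=
  W 0 /\ forall (a : R[i]) x y, W x -> W y -> W (a *: x + y).

Lemma subspace_sum W (I : Type) (r : seq I) (P : pred I) (c : I -> R[i])
    (v : I -> H) :
  is_subspace W -> (forall i, P i -> W (v i)) ->
  W (\sum_(i <- r | P i) c i *: v i).
Proof.
move=> [W0 WD] Wv; elim: r => [|i r IH]; first by rewrite big_nil.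
by rewrite big_cons; case: ifPn => // Pi; apply: WD => //; apply: Wv.
Qed.

Lemma lspan_subspace S : is_subspace (lspan S).
Proof.
split; first by exists 0%N, (fun=> 0), (fun=> 0); split=> [[]|]//; rewrite big_ord0.
move=> a x y [n [c [v [Sv ->]]]] [m [d [w [Sw ->]]]].
exists (n + m)%N, (fun i => match fintype.split i with inl j => a * c j | inr j => d j end),
  (fun i => match fintype.split i with inl j => v j | inr j => w j end).
split=> [i|]; first by case: (fintype.split i).
rewrite big_split_ord scaler_sumr /=; congr (_ + _); apply: eq_bigr => i _.
  by case: splitP => [j /= /val_inj <-|k /= ik]; rewrite ?scalerA//;
    have := ltn_ord i; rewrite ik ltnNge leq_addr.
case: splitP => [j /= ij|k /= /addnI /val_inj <-]//.
by have := ltn_ord j; rewrite -ij ltnNge leq_addr.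
Qed.

Lemma sub_lspan S : S `<=` lspan S.
Proof.
by move=> x Sx; exists 1%N, (fun=> 1), (fun=> x); rewrite big_ord1 scale1r.
Qed.

Lemma lspan_min S W : is_subspace W -> S `<=` W -> lspan S `<=` W.
Proof.
by move=> sW SW x [n [c [v [Sv ->]]]]; apply: subspace_sum => // i _; exact: SW.
Qed.

Lemma closure_normP S x :
  closure S x <-> forall e : R[i], 0 < e -> exists2 z, S z & `|x - z| < e.
Proof.
split=> [clx e e0|clx B /nbhs_ballP[e /= e0 eB]].
  have [z [Sz]] := clx _ (nbhsx_ballx x e e0).
  by rewrite -ball_normE => xz; exists z.
have [z Sz xz] := clx _ e0; exists z; split=> //.
by apply: eB; rewrite -ball_normE.
Qed.

Lemma closure_subspace W : is_subspace W -> is_subspace (closure W).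
Proof.
move=> [W0 WD]; split=> [|a x y /closure_normP clx /closure_normP cly].
  exact: subset_closure.
apply/closure_normP => e e0.
have a0 : 0 < `|a| + 1 by rewrite ltr_pwDr.
(* [|a| + 1] instead of [|a|], which may vanish. *)
have d0 : 0 < e / 2 / (`|a| + 1) by rewrite !divr_gt0.
have [z Wz xz] := clx _ d0; have [w Ww yw] := cly (e / 2) (divr_gt0 e0 (ltr0n _ 2)).
exists (a *: z + w); first exact: WD.
have -> : a *: x + y - (a *: z + w) = a *: (x - z) + (y - w).
  by rewrite scalerBr opprD addrACA.
rewrite (le_lt_trans (ler_normD _ _))// [ltRHS](splitr e) ler_ltD// normrZ.
rewrite (@le_trans _ _ ((`|a| + 1) * `|x - z|))//.
  by rewrite ler_wpM2r// lerDl.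
by rewrite mulrC -ler_pdivlMr// ltW.
Qed.

End LinearSpan.

(** * Real-valued norms *)

Section RealNorm.
Context {R : realType} {V : normedZmodType R[i]}.
Implicit Types x y : V.

Lemma rnormE x : (rnorm x)%:C = `|x|.
Proof. by rewrite /rnorm RRe_real// normr_real. Qed.

Lemma rnorm_ge0 x : 0 <= rnorm x.
Proof. by rewrite -ler0c rnormE normr_ge0. Qed.

Lemma ler_rnormD x y : rnorm (x + y) <= rnorm x + rnorm y.
Proof. by rewrite -lecR rmorphD /= !rnormE ler_normD. Qed.

Lemma ler_rnorm_sum (I : Type) (r : seq I) (F : I -> V) :
  rnorm (\sum_(i <- r) F i) <= \sum_(i <- r) rnorm (F i).
Proof.
rewrite -lecR rmorph_sum /= rnormE (le_trans (ler_norm_sum _ _ _))//.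
by apply: ler_sum => i _; rewrite rnormE.
Qed.

End RealNorm.

Lemma rnormM {R : realType} (a b : R[i]) : rnorm (a * b) = rnorm a * rnorm b.
Proof. by apply: complexI; rewrite rmorphM /= !rnormE normrM. Qed.

(** * The inner product *)

Section InnerProduct.
Context {R : realType} {H : normedModType R[i]} (dot : {dot H for Num.conj}).
Hypothesis hdot : induces_norm dot.
Implicit Types (x y z : H).

Lemma dotC x y : dot x y = (dot y x)^*.
Proof. by rewrite hermC mul1r. Qed.

Lemma rnorm_dotC x y : rnorm (dot x y) = rnorm (dot y x).
Proof. by rewrite dotC /rnorm norm_conjC. Qed.

Lemma sqr_rnorm x : rnorm x ^+ 2 = rnorm (dot x x).
Proof.
by apply: complexI; rewrite rmorphXn /= !rnormE hdot ger0_norm// dnorm_ge0.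
Qed.

Lemma dotBl x y z : dot (x - y) z = dot x z - dot y z.
Proof. exact: linearBl. Qed.

Lemma dotBr x y z : dot z (x - y) = dot z x - dot z y.
Proof. exact: linearBr. Qed.

Lemma dot_suml (I : Type) (r : seq I) (c : I -> R[i]) (v : I -> H) y :
  dot (\sum_(i <- r) c i *: v i) y = \sum_(i <- r) c i * dot (v i) y.
Proof. by rewrite linear_sumlz; apply: eq_bigr => i _; rewrite linearZl_LR. Qed.

Lemma dot_sumr (I : Type) (r : seq I) (c : I -> R[i]) (v : I -> H) y :
  dot y (\sum_(i <- r) c i *: v i) = \sum_(i <- r) (c i)^* * dot y (v i).
Proof. by rewrite linear_sumr; apply: eq_bigr => i _; rewrite linearZr_LR. Qed.

Lemma Cauchy_Schwarz x y : rnorm (dot x y) <= rnorm x * rnorm y.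
Proof.
have [->|y0] := eqVneq y 0.
  by rewrite linear0r -[leLHS]/(complex.Re `|0|) normr0 mulr_ge0// rnorm_ge0.
rewrite -ler_sqr ?nnegrE ?mulr_ge0 ?rnorm_ge0// exprMn -lecR.
rewrite [leRHS]rmorphM !rmorphXn /= !rnormE !hdot.
have yy : 0 < dot y y by rewrite dnorm_gt0.
have yyJ : (dot y y)^* = dot y y by rewrite geC0_conj// ltW.
set t := `|dot x y| ^+ 2 / dot y y.
have xat : dot x ((dot x y / dot y y) *: y) = t.
  by rewrite linearZr_LR /= rmorphM fmorphV /= yyJ mulrAC [X in X / _]mulrC -normCK.
have tJ : t^* = t by rewrite geC0_conj// divr_ge0 ?exprn_ge0 ?normr_ge0 // ltW.
(* The projection of [x] on the line of [y] leaves a residue of nonnegative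
   square. *)
have := dnorm_ge0 dot (x - (dot x y / dot y y) *: y).
rewrite dnormB dnormZ xat tJ normrM normfV (ger0_norm (ltW yy)) exprMn exprVn.
have -> : `|dot x y| ^+ 2 * dot y y ^- 2 * dot y y = t.
  by rewrite -mulrA [dot y y ^+ 2]expr2 invfM -[X in _ * X]mulrA mulVf ?mulr1// gt_eqF.
by rewrite opprD addrA addrK subr_ge0 ler_pdivrMr.
Qed.

End InnerProduct.

(** * Expansion in a dual frame *)

Lemma big_fset_split (T : choiceType) (V : nmodType) (A A' : {fset T}) (F : T -> V) :
  (A `<=` A')%fset ->
  \sum_(j <- A') F j =
  \sum_(j <- A) F j + \sum_(j <- [fset j in A' | j \notin A]%fset) F j.
Proof.
move=> AA'; rewrite (big_fsetID _ (mem A)) /=; congr (_ + _).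
congr (\sum_(j <- _) F j); congr enum_fset.
by apply/fsetP => j; rewrite !inE /=; case: (boolP (j \in A)) => [/(fsubsetP AA')->|]; rewrite ?andbF.
Qed.

(** The finite sums have a supremum.  A set [A] whose sum is within [d] of it
    leaves less than [d] to anything added to [A]. *)
Lemma small_tail (R : realType) (T : choiceType) (a : T -> R) (M : R) :
  (forall A : {fset T}, \sum_(j <- A) a j <= M) ->
  forall d : R, 0 < d -> exists A : {fset T}, forall A' : {fset T},
    (A `<=` A')%fset -> \sum_(j <- [fset j in A' | j \notin A]%fset) a j < d.
Proof.
move=> aM d d0.
pose E : set R := [set s | exists A : {fset T}, s = \sum_(j <- A) a j].
have supE : has_sup E.
  split; first by exists (\sum_(j <- fset0) a j), fset0.
  by exists M => _ [A ->].
have [_ [A ->] ltA] := sup_adherent d0 supE.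
exists A => A' AA'; have : \sum_(j <- A') a j <= sup E.
  by apply: sup_upper_bound => //; exists A'.
rewrite (big_fset_split _ _ _ _ _ AA') => leA'.
by rewrite -(ltrD2l (\sum_(j <- A) a j)) (le_lt_trans leA')// -ltrBlDr.
Qed.

Section Frames.
Context {R : realType} {H : normedModType R[i]} (dot : {dot H for Num.conj}).
Context {J : countType}.
Hypothesis hdot : induces_norm dot.
Implicit Types (f g : J -> H) (A : {fset J}) (x y : H).

Lemma frame_bessel f : is_frame dot f ->
  exists2 B : R, 0 < B & forall x A,
    \sum_(j <- A) rnorm (dot x (f j)) ^+ 2 <= B * rnorm x ^+ 2.
Proof.
move=> [A0 [B [A0gt0 AB bounds]]]; exists B; first exact: lt_le_trans AB.
move=> x A; have [_] := bounds x; rewrite -lee_fin; apply: le_trans.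
rewrite -sumEFin; apply: esum_ge; exists [set` A].
  by split=> //; exact: finite_fset.
by rewrite -fsbig_seq.
Qed.

(** Pairing [x] with the partial sums of [y = \sum_j <y, g_j> f_j] exchanges the
    roles of [f] and [g], but gives the expansion of [x] in the [g_j] only
    weakly, with a set [A'] that depends on [y]. *)
Lemma weak_dual_expansion f g x y (e : R) A :
  dual_frame_pair dot f g -> 0 < e ->
  exists2 A' : {fset J}, (A `<=` A')%fset &
    rnorm (dot x y - \sum_(j <- A') dot x (f j) * dot (g j) y) < e.
Proof.
move=> [_ _ expand] e0; set d := e / (rnorm x + 1).
have x1 : 0 < rnorm x + 1 by rewrite ltr_wpDl// rnorm_ge0.
have d0 : 0 < d by rewrite divr_gt0.
have dC0 : 0 < d%:C by rewrite ltcR.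
have tot := @summability.totally_filter J.
have [A1 _ near1] := @cvgr_dist_lt _ _ _ _ (@filter_filter _ _ tot) _ _ (expand y) _ dC0.
exists (A `|` A1)%fset; first exact: fsubsetUl.
have /= := near1 (A `|` A1)%fset (fsubsetUr _ _).
rewrite /summability.partial_sum.
rewrite -(big_seq_fsetE _ _ xpredT (fun j => dot y (g j) *: f j)) /=.
rewrite -rnormE ltcR => yd.
have -> : \sum_(j <- (A `|` A1)%fset) dot x (f j) * dot (g j) y =
    dot x (\sum_(j <- (A `|` A1)%fset) dot y (g j) *: f j).
  by rewrite dot_sumr; apply: eq_bigr => j _; rewrite mulrC -dotC.
rewrite -dotBr (le_lt_trans (Cauchy_Schwarz _ hdot _ _))//.
apply: (@le_lt_trans _ _ ((rnorm x) * d)); first by rewrite ler_wpM2l ?rnorm_ge0// ltW.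
by rewrite /d mulrCA gtr_pMr// ltr_pdivrMr// mul1r ltrDl.
Qed.

(** The weak expansion of [x] is tested on [y], the error of a partial sum over
    [A].  Then [|y|^2 = <x, y> - \sum_A <x, f_j> <g_j, y>] is, up to a small
    error, the sum of the [<x, f_j> <g_j, y>] over [A'] minus [A].  By the
    inequality between means and the Bessel bound of [g] this is at most half
    of [|y|^2] plus a multiple of a tail of [\sum_j |<x, f_j>|^2], and the tail
    is small when [A] is chosen well. *)
Lemma dual_expansion f g x (e : R) : dual_frame_pair dot f g -> 0 < e ->
  exists A : {fset J}, rnorm (x - \sum_(j <- A) dot x (f j) *: g j) ^+ 2 < e.
Proof.
move=> fg e0; have [frf frg _] := fg.
have [Bf Bf0 besf] := frame_bessel _ frf.
have [B B0 besg] := frame_bessel _ frg.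
have [A tailA] := small_tail _ _ _ _ (besf x) _ (divr_gt0 e0 (mulr_gt0 (ltr0n _ 2) B0)).
exists A; set y := x - _.
have e8 : 0 < e / 8 by rewrite divr_gt0.
have [A' AA' weak] := weak_dual_expansion _ _ x y _ A fg e8.
set D := [fset j in A' | j \notin A]%fset.
have yyE : dot y y = (dot x y - \sum_(j <- A') dot x (f j) * dot (g j) y) +
    \sum_(j <- D) dot x (f j) * dot (g j) y.
  rewrite (big_fset_split _ _ _ _ _ AA') opprD addrA subrK.
  by rewrite {1}/y dotBl dot_suml.
(* The means are weighted so that the Bessel bound turns the last sum into
   half of [|y|^2]. *)
have prodD : rnorm (\sum_(j <- D) dot x (f j) * dot (g j) y) <=
    (B / 2) * (\sum_(j <- D) rnorm (dot x (f j)) ^+ 2) +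
    (B^-1 / 2) * (\sum_(j <- D) rnorm (dot y (g j)) ^+ 2).
  rewrite (le_trans (ler_rnorm_sum _ _ _))// !mulr_sumr -big_split /=.
  apply: ler_sum => j _; rewrite rnormM (rnorm_dotC _ (g j)).
  set s := rnorm _; set t := rnorm _.
  have -> : B / 2 * s ^+ 2 + B^-1 / 2 * t ^+ 2 = s * t + (B^-1 / 2) * (B * s - t) ^+ 2.
    by field; rewrite gt_eqF.
  by rewrite lerDl mulr_ge0 ?sqr_ge0// divr_ge0// invr_ge0 ltW.
have := tailA _ AA'; rewrite -/D => tailD.
have besD := besg y D.
have h1 : B / 2 * (\sum_(j <- D) rnorm (dot x (f j)) ^+ 2) < e / 4.
  rewrite mulrC -ltr_pdivlMr ?divr_gt0//; congr (_ < _): tailD.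
  by field; rewrite gt_eqF.
have h2 : B^-1 / 2 * (\sum_(j <- D) rnorm (dot y (g j)) ^+ 2) <= rnorm y ^+ 2 / 2.
  rewrite mulrAC ler_wpM2r ?invr_ge0// mulrC ler_pdivrMr// mulrC//.
have : rnorm y ^+ 2 <= e / 8 + (e / 4 + rnorm y ^+ 2 / 2).
  rewrite {1}(sqr_rnorm _ hdot) yyE (le_trans (ler_rnormD _ _))// lerD//.
    exact: ltW.
  by rewrite (le_trans prodD)// lerD// ltW.
move: (rnorm y ^+ 2) => s; lra.
Qed.

End Frames.

(** * Bridge sets *)

Lemma fset_tnthP {J : choiceType} (A : {fset J}) j :
  j \in A -> exists k : 'I_(#|` A|), j = tnth (in_tuple A) k.
Proof. by move=> /(tnthP (in_tuple A)). Qed.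

Lemma mem_fset_tnth {J : choiceType} (A : {fset J}) (k : 'I_(#|` A|)) :
  tnth (in_tuple A) k \in A.
Proof. exact: (mem_tnth k (in_tuple A)). Qed.

(** The dimension of [V] bounds the size of the free families, and a vector
    outside the span of a family of maximal size would extend it. *)
Lemma maximal_free_family (J : countType) (K : fieldType) (V : vectType K) (v : J -> V)
    (L : {fset J}) :
  exists2 Om : {fset J}, bridge_set L Om & free (map v Om) /\
    forall j, j \notin L -> v j \in <<map v Om>>%VS.
Proof.
pose P n := `[< exists Om : {fset J}, [/\ bridge_set L Om, free (map v Om) & #|` Om| = n] >].
have P0 : exists n, P n.
  exists 0%N; apply/asboolP; exists fset0.
  by split; [exact: fdisjoint0X|exact: nil_free|exact: cardfs0].
have Pmax n : P n -> (n <= \dim {:V})%N.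
  move=> /asboolP[Om [_ freeO <-]].
  by rewrite -(size_map v) -(eqnP freeO) dimvS// subvf.
have [n /asboolP[Om [OmL freeO On]] nmax] := ex_maxnP P0 Pmax.
exists Om => //; split=> // j jL; apply: contraT => vj.
have jO : j \notin Om by apply: contra vj => jO; apply/memv_span/map_f.
suff /nmax : P n.+1 by rewrite ltnn.
apply/asboolP; exists (j |` Om)%fset; split.
- by rewrite /bridge_set fdisjointU1X jL.
- have /perm_free -> : perm_eq (map v (j |` Om)%fset) (v j :: map v Om).
    rewrite -map_cons; apply: perm_map; apply: uniq_perm => [||i].
      exact: fset_uniq.
      by apply/andP; split; [exact: jO|exact: fset_uniq].
    by rewrite !inE.
  by rewrite free_cons vj.
- by rewrite cardfsU1 jO On.
Qed.

Section BridgeSets.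
Context {R : realType} {H : normedModType R[i]} (dot : {dot H for Num.conj}).
Context {J : countType}.
Hypothesis hdot : induces_norm dot.
Implicit Types (f g : J -> H) (A L Om : {fset J}) (x y : H).

(** Serves twice below: with [W] the span of the [g_j] that are not erased, for
    an [x] whose coefficients on the erased ones vanish; then with [W] the
    closure of that span, for every [x]. *)
Lemma dense_synthesis f g (W : set H) x : dual_frame_pair dot f g ->
  (forall A, W (\sum_(j <- A) dot x (f j) *: g j)) -> closure W x.
Proof.
move=> fg Wx; apply/closure_normP => e e0.
have [d d0 ed] : exists2 d : R, 0 < d & e = d%:C.
  by exists (complex.Re e); rewrite -?ltcR RRe_real// gtr0_real.
have [A xA] := dual_expansion dot hdot f g x (d ^+ 2) fg (exprn_gt0 2 d0).
exists (\sum_(j <- A) dot x (f j) *: g j) => //.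
rewrite ed -rnormE ltcR -ltr_sqr// ?nnegrE ?rnorm_ge0//.
exact: ltW.
Qed.

Lemma robust_redundancy f g L Om : dual_frame_pair dot f g ->
  bridge_set L Om -> robust dot f g L Om -> minimal_redundancy g L.
Proof.
move=> fg /fdisjointP OmL [C BC].
set G := [set g j | j in [set j | j \notin L]].
have subG := lspan_subspace G; have subcl := closure_subspace _ subG.
have outG j : j \notin L -> lspan G (g j).
  by move=> jL; apply: sub_lspan; exists j.
have clg j : closure (lspan G) (g j).
  have [/fset_tnthP[k ->]|jL] := boolP (j \in L); last first.
    exact/subset_closure/outG.
  set gk := g _.
  pose g' := \sum_(l < #|` Om|) (C l k)^* *: g (tnth (in_tuple Om) l).
  have Gg' : lspan G g'.
    apply: subspace_sum => // l _; apply: outG; apply: OmL; exact: mem_fset_tnth.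
  pose h := gk - g'.
  have hf i : i \in L -> dot h (f i) = 0.
    move=> /fset_tnthP[i' ->]; rewrite dotC; apply/eqP; rewrite conjC_eq0; apply/eqP.
    rewrite dotBr; apply/eqP; rewrite subr_eq0; apply/eqP.
    rewrite /gk; have /matrixP/(_ i' k) := BC; rewrite !mxE => <-.
    rewrite dot_sumr; apply: eq_bigr => l _.
    by rewrite !mxE conjCK mulrC.
  have clh : closure (lspan G) h.
    apply: (dense_synthesis f g) => // A.
    rewrite (bigID (mem L)) /= big1 ?add0r; last first.
      by move=> i iL; rewrite hf// scale0r.
    exact: subspace_sum.
  rewrite (_ : gk = 1 *: h + g'); last by rewrite scale1r subrK.
  apply: subcl.2 => //; exact: subset_closure.
apply/seteqP; split=> // x _.
have /closure_id -> := @closed_closure _ (lspan G).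
by apply: (dense_synthesis f g) => // A; exact: subspace_sum.
Qed.

(** A vector of the span orthogonal to [y] is at distance at least [|y|] from
    [y], by Pythagoras; so [y] is in the closure only if it is zero. *)
Lemma orthogonal_outside_eq0 g L y : minimal_redundancy g L ->
  (forall j, j \notin L -> dot y (g j) = 0) -> y = 0.
Proof.
move=> red yg; apply/eqP; apply: contraT => y0.
have : closure (lspan [set g j | j in [set j | j \notin L]]) y by rewrite red.
move=> /closure_normP/(_ `|y|); rewrite normr_gt0 => /(_ y0)[z Sz].
move=> yz_lt; have yz : dot y z = 0.
  case: Sz => n [c [v [Sv ->]]]; rewrite dot_sumr big1// => i _.
  by have [j jL <-] := Sv i; rewrite yg// mulr0.
have : dot (y - z) (y - z) < dot y y by rewrite -!hdot ltr_sqr ?nnegrE.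
by move=> /lt_geF; rewrite (hnormBd yz) lerDl dnorm_ge0.
Qed.

Definition analysis_col f g L k : 'cV[R[i]]_(#|` L|) :=
  \col_i dot (f (tnth (in_tuple L) i)) (g k).

Lemma col_bridge_mx f g L Om (k : 'I_(#|` Om|)) :
  col k (bridge_mx dot f g L Om) = analysis_col f g L (tnth (in_tuple Om) k).
Proof. by apply/matrixP => i l; rewrite !mxE. Qed.

Lemma redundancy_robust f g L : minimal_redundancy g L ->
  exists Om, [/\ bridge_set L Om, robust dot f g L Om &
    has_dim (lspan [set f j | j in [set` L]]) #|` Om|].
Proof.
move=> red.
have [Om OmL [freeO spanO]] := maximal_free_family _ _ _ (analysis_col f g L) L.
exists Om; set B := bridge_mx dot f g L Om.
have fullB : row_full B.
  rewrite -[row_full _]/(\rank B == _) -mxrank_tr; apply: inj_row_free => c cB.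
  apply/rowP => k; rewrite mxE.
  have /freeP fr : free (map_tuple (analysis_col f g L) (in_tuple Om)) := freeO.
  apply: (fr (c 0)) => {k}.
  apply/colP => i; rewrite summxE mxE; have /rowP/(_ i) := cB; rewrite !mxE => cBi.
  rewrite -[RHS]cBi; apply: eq_bigr => l _.
  by rewrite -tnth_nth tnth_map !mxE.
have PB : pinvmx B *m B = 1%:M := mulVpmx fullB.
set P := pinvmx B in PB.
(* A linear relation between the rows of [B] is one between the [f_j]. *)
have ann m (D : 'M[R[i]]_(m, #|` L|)) : D *m B = 0 -> forall i,
    \sum_j D i j *: f (tnth (in_tuple L) j) = 0.
  move=> DB i; apply: (orthogonal_outside_eq0 g L) => // k kL.
  have Dv : {in <<map (analysis_col f g L) Om>>%VS, forall w, D *m w = 0}.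
    move=> w; suff /subvP kerD : (<<map (analysis_col f g L) Om>> <= lker (linfun (mulmx D)))%VS.
      by move=> /kerD; rewrite memv_ker lfunE => /eqP.
    apply/span_subvP => _ /mapP[l /fset_tnthP[l' ->] ->].
    by rewrite memv_ker lfunE /= -col_bridge_mx colE mulmxA DB mul0mx.
  rewrite dot_suml; have /colP/(_ i) := Dv _ (spanO k kL); rewrite !mxE => Dvi.
  by rewrite -[RHS]Dvi; apply: eq_bigr => j _; rewrite !mxE.
have fE i : f (tnth (in_tuple L) i) =
    \sum_j (B *m P) i j *: f (tnth (in_tuple L) j).
  have := ann _ (1%:M - B *m P); rewrite mulmxBl mul1mx -mulmxA PB mulmx1 subrr.
  move=> /(_ erefl i); under eq_bigr do rewrite mxE [X in _ + X]mxE scalerBl.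
  rewrite sumrB (bigD1 i)//= mxE eqxx scale1r big1 ?addr0.
    by move=> /subr0_eq.
  by move=> j ij; rewrite mxE eq_sym (negbTE ij) scale0r.
pose b k := \sum_j P k j *: f (tnth (in_tuple L) j).
split=> //.
- exists (P *m bridge_mx dot f g L L); apply/matrixP => i k.
  rewrite mulmxA mxE [RHS]mxE [in RHS]fE dot_suml.
  by apply: eq_bigr => j _; rewrite [X in _ * X]mxE.
- have dotb k l : dot (b k) (g (tnth (in_tuple Om) l)) = (k == l)%:R.
    have /matrixP/(_ k l) := PB; rewrite !mxE => <-.
    by rewrite dot_suml; apply: eq_bigr => j _; rewrite !mxE.
  exists b; split.
    move=> c cb k; have /(congr1 (fun y => dot y (g (tnth (in_tuple Om) k)))) := cb.
    rewrite /= linear0l dot_suml (bigD1 k)//= dotb eqxx mulr1 big1 ?addr0//.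
    by move=> l lk; rewrite dotb (negbTE lk) mulr0.
  apply/seteqP; split; apply: lspan_min; try exact: lspan_subspace.
    move=> _ [k _ <-]; apply: subspace_sum; first exact: lspan_subspace.
    by move=> j _; apply: sub_lspan; exists (tnth (in_tuple L) j) => //=; exact: mem_fset_tnth.
  move=> _ [j /= /fset_tnthP[i ->] <-].
  have -> : f (tnth (in_tuple L) i) = \sum_k B i k *: b k.
    rewrite fE /b; under [RHS]eq_bigr do rewrite scaler_sumr.
    rewrite exchange_big /=; apply: eq_bigr => l _; rewrite mxE scaler_suml.
    by apply: eq_bigr => k _; rewrite scalerA.
  apply: subspace_sum; first exact: lspan_subspace.
  by move=> k _; apply: sub_lspan; exists k.
Qed.

End BridgeSets.

Theorem theorem3p7 (R : realType) (H : completeNormedModType R[i])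
    (dot : {dot H for Num.conj}) (hdot : induces_norm dot)
    (J : countType) (f g : J -> H) (hfg : dual_frame_pair dot f g)
    (Lambda : {fset J}) :
  ((exists Omega : {fset J},
      bridge_set Lambda Omega /\ robust dot f g Lambda Omega) <->
   minimal_redundancy g Lambda) /\
  (minimal_redundancy g Lambda ->
   exists Omega : {fset J},
     [/\ bridge_set Lambda Omega, robust dot f g Lambda Omega &
         has_dim (lspan [set f j | j in [set` Lambda]]) #|` Omega|]).
Proof.
split; last exact: redundancy_robust.
split=> [[Om [OmL robOm]]|red]; first exact: robust_redundancy hfg OmL robOm.
by have [Om [OmL robOm _]] := redundancy_robust dot hdot f g Lambda red; exists Om.
Qed.
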